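(* Let $V$ be a finite-dimensional vector space over a field $k$ with an arbitrary bilinear form $B$, and let $\lrcorner_B$ denote the left contraction on $\bigwedge V$ with respect to $B$. Then for arbitrary $u,v,w\in\bigwedge V$ $$w\,\lrcorner_B\,(u\wedge v)\;=\;(-1)^{|w_{(1)}|\,|w_{(2)}\lrcorner_B u|}\;(w_{(2)}\,\lrcorner_B\,u)\wedge(w_{(1)}\,\lrcorner_B\,v),$$ where $\Delta(w)=w_{(1)}\otimes w_{(2)}$ is the Grassmann co-product, the sum over its terms is understood, and $|\cdot|$ denotes the grade of homogeneous elements (the formula is read on homogeneous components and extended linearly).
   Context: The Grassmann co-product $\Delta(x)=x_{(1)}\otimes x_{(2)}$ (Sweedler notation) on $\bigwedge V$ is the algebra homomorphism into the graded tensor product $\bigwedge V\hat\otimes\bigwedge V$ with $\Delta(v)=v\otimes1+1\otimes v$ for $v\in V$. $B$ is extended to $B^{\wedge}:\bigwedge V\times\bigwedge V\to k$ by $B^\wedge(1,1)=1$, $B^{\wedge}(x_1\wedge\cdots\wedge x_r,\,y_1\wedge\cdots\wedge y_r)=(-1)^{r(r-1)/2}\det[B(x_i,y_j)]$ for $x_i,y_j\in V$, and $B^\wedge=0$ on pairs of different grades. The left contraction is defined by $u\,\lrcorner_B\,w=B^\wedge(u,w_{(1)})\,w_{(2)}$. *)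

(* Defs.v *)
From HB Require Import structures.
From mathcomp Require Import all_boot all_order all_algebra.

Set Implicit Arguments.
Unset Strict Implicit.
Unset Printing Implicit Defensive.

Import GRing.Theory.
Local Open Scope ring_scope.

Section LinearExtension.
Variable k : fieldType.
Implicit Types (X Y : finType) (W : lmodType k).

Definition fdelta X (a : X) : {ffun X -> k^o} := [ffun b => (b == a)%:R].

Definition linext X W (f : X -> W) (x : {ffun X -> k^o}) : W :=
  \sum_a (x a : k) *: f a.

Definition bilext X Y W (f : X -> Y -> W)
  (x : {ffun X -> k^o}) (y : {ffun Y -> k^o}) : W :=
  linext (fun a => linext (f a) y) x.

Lemma linext_is_linear X W (f : X -> W) : linear (linext f).
Proof.
move=> c x y; rewrite /linext scaler_sumr -big_split /=.
by apply: eq_bigr => a _; rewrite !ffunE scalerDl scalerA.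
Qed.
HB.instance Definition _ X W (f : X -> W) :=
  GRing.isLinear.Build k {ffun X -> k^o} W *:%R (linext f) (linext_is_linear f).

Lemma linext_scale X W (f : X -> W) c x : linext f (c *: x) = c *: linext f x.
Proof. exact: linearZ. Qed.

Lemma linext0 X W (f : X -> W) : linext f 0 = 0.
Proof. exact: linear0. Qed.

Lemma linext_delta X W (f : X -> W) a : linext f (fdelta a) = f a.
Proof.
rewrite /linext (bigD1 a) //= ffunE eqxx scale1r big1 ?addr0 // => b /negPf.
by rewrite ffunE => ->; rewrite scale0r.
Qed.

Lemma linext_id X (x : {ffun X -> k^o}) : linext (@fdelta X) x = x.
Proof.
apply/ffunP => a; rewrite /linext sum_ffunE (bigD1 a) //= !ffunE eqxx.
rewrite big1 ?addr0; first by rewrite [LHS]mulr1.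
by move=> b; rewrite eq_sym => /negPf nab; rewrite !ffunE nab [LHS]mulr0.
Qed.

Lemma eq_linext X W (f g : X -> W) x : f =1 g -> linext f x = linext g x.
Proof. by move=> e; apply: eq_bigr => a _; rewrite e. Qed.

Lemma linear_linext X W W' (g : {linear W -> W'}) (f : X -> W) x :
  g (linext f x) = linext (fun a => g (f a)) x.
Proof. by rewrite linear_sum; apply: eq_bigr => a _; rewrite linearZ. Qed.

Lemma linear_linext' X W W' (g : W -> W') (lg : linear g) (f : X -> W) x :
  g (linext f x) = linext (fun a => g (f a)) x.
Proof.
pose gL := GRing.isLinear.Build k W W' *:%R g lg.
pose g' : {linear W -> W'} := HB.pack g gL; exact: (linear_linext g').
Qed.

Lemma linextD X W (f g : X -> W) x :
  linext (fun a => f a + g a) x = linext f x + linext g x.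
Proof. by rewrite -big_split; apply: eq_bigr => a _; rewrite scalerDr. Qed.

Lemma linextZ X W c (f : X -> W) x :
  linext (fun a => c *: f a) x = c *: linext f x.
Proof.
by rewrite scaler_sumr; apply: eq_bigr => a _; rewrite !scalerA mulrC.
Qed.

Lemma bilext_linl X Y W (f : X -> Y -> W) y : linear (fun x => bilext f x y).
Proof. by move=> c x x'; rewrite /bilext linearP. Qed.

Lemma bilext_linr X Y W (f : X -> Y -> W) x : linear (bilext f x).
Proof.
move=> c y y'; rewrite /bilext -linextZ -linextD.
by apply: eq_linext => a; rewrite linearP.
Qed.
HB.instance Definition _ X Y W (f : X -> Y -> W) x :=
  GRing.isLinear.Build k {ffun Y -> k^o} W *:%R (bilext f x) (bilext_linr f x).

Lemma bilext_delta X Y W (f : X -> Y -> W) a b :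
  bilext f (fdelta a) (fdelta b) = f a b.
Proof. by rewrite /bilext !linext_delta. Qed.

Lemma bilextC X Y W (f : X -> Y -> W) x y :
  bilext f x y = bilext (fun b a => f a b) y x.
Proof.
rewrite /bilext /linext; under eq_bigr => a _ do rewrite scaler_sumr.
rewrite exchange_big /=; apply: eq_bigr => b _; rewrite scaler_sumr.
by apply: eq_bigr => a _; rewrite !scalerA mulrC.
Qed.

Lemma bilext_assoc X (op : X -> X -> {ffun X -> k^o}) :
    (forall a b c, linext (op^~ c) (op a b) = linext (op a) (op b c)) ->
  associative (bilext op).
Proof.
move=> opA x y z; rewrite /bilext linear_linext; apply: eq_linext => a.
rewrite !linear_linext; apply: eq_linext => b /=; rewrite linear_linext.
rewrite -(eq_linext _ (opA a b)); set w := op a b; symmetry.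
transitivity (bilext op w (linext (@fdelta X) z)).
  by rewrite linext_id.
rewrite (linear_linext (bilext op w)); apply: eq_linext => c.
by rewrite /bilext; apply: eq_linext => d; rewrite linext_delta.
Qed.
End LinearExtension.

Section ExteriorAlgebra.
Variables (k : fieldType) (V : vectType k).

(* The exterior algebra of V in coordinates: for S = {i_1 < ... < i_r},        *)
(* ebase S stands for e_{i_1} /\ ... /\ e_{i_r}, with e = vbasis {:V}, and the *)
(* exterior product is written *. The universal property of extv : V ->        *)
(* exterior (hence independence of the basis, up to unique isomorphism) is     *)
(* extv_sq, extlift_extv, extlift_is_monoid_morphism and extlift_unique.       *)
Definition exterior := {ffun {set 'I_(\dim {:V})} -> k^o}.
HB.instance Definition _ := Vector.copy exterior
  {ffun {set 'I_(\dim {:V})} -> k^o}.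
Implicit Types S T U : {set 'I_(\dim {:V})}.

(* The number of adjacent transpositions needed to sort S followed by T. *)
Definition ninv S T : nat := (\sum_(i in S) \sum_(j in T) (j < i))%N.

Definition ebase S : exterior := fdelta k S.

Definition wedge_base S T : exterior :=
  if [disjoint S & T] then (-1) ^+ ninv S T *: ebase (S :|: T) else 0.

Definition wedge : exterior -> exterior -> exterior := bilext wedge_base.

Lemma ninvUl S T U : [disjoint S & T] ->
  ninv (S :|: T) U = (ninv S U + ninv T U)%N.
Proof.
by move=> dST; rewrite /ninv -bigU //; apply: eq_bigl => i; rewrite !inE.
Qed.

Lemma ninvUr S T U : [disjoint T & U] ->
  ninv S (T :|: U) = (ninv S T + ninv S U)%N.
Proof.
move=> dTU; rewrite /ninv -big_split; apply: eq_bigr => i _.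
by rewrite -bigU //; apply: eq_bigl => j; rewrite !inE.
Qed.

Lemma disjointsU S T U :
  [disjoint S & T :|: U] = [disjoint S & T] && [disjoint S & U].
Proof. by rewrite -!setI_eq0 setIUr setU_eq0. Qed.

Lemma disjointUs S T U :
  [disjoint S :|: T & U] = [disjoint S & U] && [disjoint T & U].
Proof. by rewrite -!setI_eq0 setIUl setU_eq0. Qed.

Let linext_extZ (f : _ -> exterior) c (x : exterior) :
  linext f (c *: x) = c *: linext f x.
Proof. exact: linext_scale. Qed.

Let wedge_baseE S T : wedge_base S T =
  if [disjoint S & T] then (-1) ^+ ninv S T *: ebase (S :|: T) else 0.
Proof. by []. Qed.

Lemma wedge_baseA S T U :
  linext (wedge_base^~ U) (wedge_base S T) =
  linext (wedge_base S) (wedge_base T U).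
Proof.
rewrite [wedge_base S T]wedge_baseE [wedge_base T U]wedge_baseE.
case: ifP => dST; case: ifP => dTU;
  rewrite ?linext0 ?linext_extZ ?linext_delta ?scaler0 //= /wedge_base.
- rewrite disjointUs disjointsU dST dTU andbT /=; case: ifP => dSU //.
    rewrite !scalerA -!exprD ninvUl // ninvUr // setUA.
    by congr (_ ^+ _ *: _); rewrite [RHS]addnC addnA.
  by rewrite !scaler0.
- by rewrite disjointUs dTU andbF scaler0.
- by rewrite disjointsU dST scaler0.
Qed.

Lemma wedgeA : associative wedge.
Proof. exact/bilext_assoc/wedge_baseA. Qed.

Lemma wedge_base0l S : wedge_base set0 S = ebase S.
Proof.
by rewrite /wedge_base -setI_eq0 set0I eqxx /ninv big_set0 expr0 scale1r set0U.
Qed.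

Lemma wedge_base0r S : wedge_base S set0 = ebase S.
Proof.
rewrite /wedge_base -setI_eq0 setI0 eqxx /ninv big1 ?expr0 ?scale1r ?setU0 //.
by move=> i _; rewrite big_set0.
Qed.

Lemma wedge1x : left_id (ebase set0) wedge.
Proof.
move=> x; rewrite /wedge /bilext linext_delta -[RHS]linext_id.
exact/eq_linext/wedge_base0l.
Qed.

Lemma wedgex1 : right_id (ebase set0) wedge.
Proof.
move=> x; rewrite /wedge /bilext -[RHS]linext_id; apply: eq_linext => S.
by rewrite linext_delta wedge_base0r.
Qed.

Lemma wedgeDl : left_distributive wedge +%R.
Proof. by move=> x y z; have := bilext_linl wedge_base z 1 x y; rewrite !scale1r. Qed.

Lemma wedgeDr : right_distributive wedge +%R.
Proof. by move=> x y z; rewrite /wedge linearD. Qed.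

Lemma ext1_neq0 : ebase set0 != 0.
Proof. by apply/eqP => /ffunP/(_ set0)/eqP; rewrite !ffunE eqxx oner_eq0. Qed.

HB.instance Definition _ := GRing.Zmodule_isNzRing.Build exterior
  wedgeA wedge1x wedgex1 wedgeDl wedgeDr ext1_neq0.

Lemma wedgeZl c (x y : exterior) : c *: (x * y) = (c *: x) * y.
Proof.
have := bilext_linl wedge_base y c x 0; rewrite !addr0 => /esym.
by rewrite [bilext _ 0 _]linear0 addr0.
Qed.
HB.instance Definition _ :=
  GRing.Lmodule_isLalgebra.Build k exterior wedgeZl.

Lemma wedgeZr c (x y : exterior) : c *: (x * y) = x * (c *: y).
Proof. by rewrite [RHS]linearZ. Qed.
HB.instance Definition _ :=
  GRing.Lalgebra_isAlgebra.Build k exterior wedgeZr.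

Local Notation vb := (vbasis {:V}).

Definition extv (v : V) : exterior :=
  \sum_i (coord vb i v) *: ebase [set i].

Lemma extv_is_linear : linear extv.
Proof.
move=> c u v; rewrite /extv scaler_sumr -big_split; apply: eq_bigr => i _ /=.
by rewrite linearP scalerDl scalerA.
Qed.
HB.instance Definition _ := GRing.isLinear.Build k V exterior *:%R extv
  extv_is_linear.

Definition bvecs S : seq V := [seq vb`_i | i : 'I_(\dim {:V}) <- enum S].

Lemma extv_vb (i : 'I_(\dim {:V})) : extv vb`_i = ebase [set i].
Proof.
have fvb := basis_free (vbasisP {:V}).
rewrite /extv (bigD1 i) //= coord_free // eqxx scale1r big1 ?addr0 // => j.
by rewrite coord_free // => /negPf; rewrite eq_sym -val_eqE /= => ->; rewrite scale0r.
Qed.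

Definition ltb (i j : 'I_(\dim {:V})) := (i < j)%N.

Lemma ltb_trans : transitive ltb. Proof. by move=> ? ? ?; apply: ltn_trans. Qed.
Lemma ltb_irr : irreflexive ltb. Proof. by move=> ?; apply: ltnn. Qed.

Lemma sorted_enum S : sorted ltb (enum S).
Proof.
rewrite /enum_mem -enumT; apply: (sorted_filter ltb_trans).
have := iota_ltn_sorted 0 (\dim {:V}); rewrite -val_enum_ord.
by rewrite sorted_map.
Qed.

Lemma enum_sortedE (s : seq 'I_(\dim {:V})) S :
  sorted ltb s -> s =i S -> s = enum S.
Proof.
move=> ss sS; apply: (irr_sorted_eq ltb_trans ltb_irr ss (sorted_enum S)).
by move=> i; rewrite sS mem_enum.
Qed.

Lemma ninv1 i S : ninv [set i] S = count (ltb^~ i) (enum S).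
Proof.
rewrite /ninv big_set1 -sum1_count -big_enum /= [RHS]big_mkcond /=.
by apply: eq_bigr => j _; rewrite /ltb; case: ltnP.
Qed.

Lemma wedge_base1 i S : ebase [set i] * ebase S =
  if i \in S then 0 else (-1) ^+ count (ltb^~ i) (enum S) *: ebase (i |: S).
Proof.
rewrite -[LHS]/(wedge _ _) /wedge bilext_delta /wedge_base disjoints1 ninv1.
by case: (i \in S).
Qed.

Lemma prod_bvecs S : \prod_(v <- bvecs S) extv v = ebase S.
Proof.
rewrite big_map; have := sorted_enum S.
have : enum S =i S by move=> i; rewrite mem_enum.
move: (enum S) => s; elim: s S => [|i s IHs] T sT ss.
  by rewrite big_nil; congr ebase; apply/setP => i; rewrite -sT inE.
rewrite big_cons extv_vb (IHs [set j in s]) ?(path_sorted ss) //; last first.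
  by move=> j; rewrite inE.
move: ss; rewrite /= path_sortedE; last exact: ltb_trans.
case/andP => /allP lts ss.
rewrite wedge_base1 inE; case: ifP => [/lts|_]; first by rewrite ltb_irr.
rewrite (_ : count _ _ = 0%N) ?scale1r.
  by congr ebase; apply/setP => j; rewrite -sT !inE.
apply/eqP; rewrite -leqn0 leqNgt -has_count; apply/hasPn => j.
by rewrite mem_enum inE => /lts; rewrite /ltb -leqNgt => /ltnW.
Qed.

Section Alternating.
Variables (W : lmodType k) (D : seq V -> W).
Hypothesis Dlin : forall p s, linear (fun v => D (p ++ v :: s)).
Hypothesis Dalt : forall p v s, D (p ++ v :: v :: s) = 0.

Let Dadd p u v s : D (p ++ (u + v) :: s) = D (p ++ u :: s) + D (p ++ v :: s).
Proof. by have := Dlin p s 1 u v; rewrite /= !scale1r. Qed.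

Let Dswap p u v s : D (p ++ u :: v :: s) = - D (p ++ v :: u :: s).
Proof.
apply/eqP; rewrite -addr_eq0; apply/eqP; have := Dalt p (u + v) s.
rewrite Dadd -![p ++ _ :: _ + _ :: _]cat_rcons !Dadd !cat_rcons !Dalt.
by rewrite add0r addr0.
Qed.

Let Dins (i : 'I_(\dim {:V})) (s : seq 'I_(\dim {:V})) p : sorted ltb s ->
  if i \in s then D (p ++ vb`_i :: [seq vb`_j | j : 'I__ <- s]) = 0 else
  exists s', [/\ sorted ltb s', s' =i i :: s &
    D (p ++ vb`_i :: [seq vb`_j | j : 'I__ <- s]) =
    (-1) ^+ count (ltb^~ i) s *: D (p ++ [seq vb`_j | j : 'I__ <- s'])].
Proof.
elim: s p => [|j s IHs] p.
  by exists [:: i]; split=> //; rewrite scale1r.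
rewrite /= path_sortedE; last exact: ltb_trans.
case/andP => /allP lts ss; rewrite inE; have [ltij|ltji|/val_inj->] := ltngtP i j; last by rewrite eqxx.
- rewrite -val_eqE /= (ltn_eqF ltij) /=.
  have -> : i \in s = false.
    by apply/negP => /lts; rewrite /ltb ltnNge (ltnW ltij).
  exists (i :: j :: s); split=> //.
    rewrite /= {1}/ltb ltij /= path_sortedE ?ss ?andbT; last exact: ltb_trans.
    exact/allP.
  rewrite /ltb (ltnNge j) (ltnW ltij) /= (_ : count _ _ = 0%N) ?scale1r //.
  apply/eqP; rewrite -leqn0 leqNgt -has_count; apply/hasPn => l /lts ltjl.
  by rewrite -leqNgt ltnW // (ltn_trans ltij).
- rewrite -val_eqE /= (gtn_eqF ltji) /= Dswap -cat_rcons.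
  have := IHs (rcons p vb`_j) ss; case: ifP => [_ ->|nis [s' [ss' s'E ->]]].
    by rewrite oppr0.
  exists (j :: s'); split.
  - rewrite /= path_sortedE ?ss' ?andbT; last exact: ltb_trans.
    by apply/allP => l; rewrite s'E inE => /predU1P[->|/lts].
  - by move=> l; rewrite !inE s'E inE orbCA.
  - by rewrite /ltb ltji exprS mulN1r scaleNr cat_rcons.
Qed.

Definition altext p : exterior -> W := linext (fun S => D (p ++ bvecs S)).
HB.instance Definition _ p := GRing.Linear.on (altext p).

Lemma altext_ebase p S : altext p (ebase S) = D (p ++ bvecs S).
Proof. exact: linext_delta. Qed.

Lemma altext_base p i S :
  altext p (ebase [set i] * ebase S) = D (p ++ vb`_i :: bvecs S).
Proof.
rewrite wedge_base1; have := Dins i p (sorted_enum S).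
rewrite mem_enum; case: ifP => [_ /= ->|_ [s [ss sE /= ->]]].
  by rewrite linear0.
rewrite linearZ /= altext_ebase; congr (_ *: D (_ ++ _)).
rewrite /bvecs; congr map; apply/esym/enum_sortedE => // j.
by rewrite sE !inE mem_enum.
Qed.

Lemma altext_extv p v (x : exterior) : altext p (extv v * x) = altext (rcons p v) x.
Proof.
have Dl u : linear (fun v => altext (rcons p v) u).
  move=> c v1 v2; rewrite /altext -linextZ -linextD; apply: eq_linext => S.
  by rewrite !cat_rcons Dlin.
have linE (f g : V -> W) : linear f -> linear g ->
    (forall i : 'I_(\dim {:V}), f vb`_i = g vb`_i) -> f v = g v.
  move=> lf lg fg; pose F := GRing.isLinear.Build k V W *:%R f lf.
  pose G := GRing.isLinear.Build k V W *:%R g lg.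
  pose f' : {linear V -> W} := HB.pack f F; pose g' : {linear V -> W} := HB.pack g G.
  rewrite -[f]/(f' : V -> W) -[g]/(g' : V -> W) (coord_vbasis (memvf v)) !linear_sum.
  by apply: eq_bigr => i _; rewrite !linearZ /= fg.
apply: (linE (fun v => altext p (extv v * x)) (fun v => altext (rcons p v) x)) => //.
  by move=> c v1 v2; rewrite !linearP mulrDl -scalerAl linearP.
move=> i; rewrite extv_vb -[x in LHS](@linext_id k) /linext mulr_sumr linear_sum.
apply: eq_bigr => S _; rewrite -scalerAr linearZ /= altext_base.
by rewrite cat_rcons.
Qed.

Lemma altext_prod p vs (x : exterior) :
  altext p (\prod_(v <- vs) extv v * x) = altext (p ++ vs) x.
Proof.
elim: vs p => [|v vs IHvs] p; first by rewrite big_nil mul1r cats0.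
by rewrite big_cons -mulrA altext_extv IHvs cat_rcons.
Qed.

Lemma altext1 p : altext p 1 = D p.
Proof. by rewrite [LHS]altext_ebase /bvecs enum_set0 cats0. Qed.
End Alternating.

Lemma ebase_anti i j :
  ebase [set i] * ebase [set j] = - (ebase [set j] * ebase [set i]).
Proof.
rewrite !wedge_base1 !enum_set1 !inE eq_sym /= !addn0 /ltb setUC.
have [ltij|ltji|/val_inj->] := ltngtP i j; last by rewrite eqxx oppr0.
  by rewrite -val_eqE /= (gtn_eqF ltij) scaleN1r scale1r opprK.
by rewrite -val_eqE /= (ltn_eqF ltji) scaleN1r scale1r.
Qed.

Lemma extv_sq v : extv v * extv v = 0.
Proof.
suff [] : extv v * extv v = 0 /\
  forall j, extv v * ebase [set j] = - (ebase [set j] * extv v) by [].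
rewrite /extv; elim/big_rec: _ => [|i x _ [xx xe]].
  by split=> [|j]; rewrite ?mulr0 // mul0r oppr0.
split=> [|j].
  rewrite mulrDl !mulrDr xx addr0 -!scalerAl -!scalerAr wedge_base1 set11.
  by rewrite !scaler0 add0r xe scalerN subrr.
by rewrite mulrDl mulrDr -scalerAl -scalerAr xe ebase_anti scalerN opprD.
Qed.

(* For linear f with f v * f v = 0, the algebra morphism extending f. *)
Definition extlift (A : algType k) (f : V -> A) : exterior -> A :=
  linext (fun S => \prod_(v <- bvecs S) f v).

Section Lift.
Variables (A : algType k) (f : V -> A).
HB.instance Definition _ := GRing.Linear.on (extlift f).
Hypotheses (flin : linear f) (fsq : forall v, f v * f v = 0).

Let D (vs : seq V) := \prod_(v <- vs) f v.

Let Dlin p s : linear (fun v => D (p ++ v :: s)).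
Proof.
move=> c u v; rewrite /D !big_cat !big_cons /= flin mulrDl mulrDr.
by rewrite -scalerAl -scalerAr.
Qed.

Let Dalt p v s : D (p ++ v :: v :: s) = 0.
Proof.
by rewrite /D big_cat !big_cons /= [f v * (_ * _)]mulrA fsq mul0r mulr0.
Qed.

Lemma extlift_extv v : extlift f (extv v) = f v.
Proof.
have := altext_extv Dlin Dalt [::] v 1; rewrite mulr1 altext1.
by rewrite /D /= big_seq1.
Qed.

Lemma extlift_is_monoid_morphism : monoid_morphism (extlift f).
Proof.
split=> [|x y]; first by rewrite [LHS](altext1 D [::]) /D big_nil.
rewrite -[x](@linext_id k) /linext mulr_suml !linear_sum /= mulr_suml.
apply: eq_bigr => S _; rewrite -scalerAl !linearZ /= -scalerAl; congr (_ *: _).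
rewrite -/(ebase S) -prod_bvecs; have := altext_prod Dlin Dalt [::] (bvecs S) y.
rewrite prod_bvecs [extlift f (ebase S)]linext_delta => /= e.
rewrite -[LHS]/(altext D [::] _) e /altext /extlift.
rewrite /linext mulr_sumr; apply: eq_bigr => T _.
by rewrite /D big_cat scalerAr.
Qed.
End Lift.

Lemma extlift_unique (A : algType k) (g : {lrmorphism exterior -> A}) x :
  g x = extlift (fun v => g (extv v)) x.
Proof.
rewrite -[x in LHS](@linext_id k) (linear_linext g); apply: eq_linext => S.
by rewrite -/(ebase S) -prod_bvecs rmorph_prod.
Qed.

(* Homogeneous component of grade d; exterior products of d vectors are        *)
(* homogeneous of grade d, see homog_prod.                                     *)
Definition hcomp (d : nat) (x : exterior) : exterior :=
  [ffun S : {set 'I_(\dim {:V})} => if #|S| == d then x S else 0].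

Lemma hcomp_is_linear d : linear (hcomp d).
Proof.
move=> c x y; apply/ffunP => S; rewrite !ffunE.
by case: ifP => // _; rewrite scaler0 addr0.
Qed.
HB.instance Definition _ d :=
  GRing.isLinear.Build k exterior exterior *:%R (hcomp d) (hcomp_is_linear d).

Lemma hcomp_ebase d S : hcomp d (ebase S) = if #|S| == d then ebase S else 0.
Proof.
apply/ffunP => T; rewrite !ffunE; case: (eqVneq T S) => [->|/negPf nTS].
  by case: ifP; rewrite ?ffunE ?eqxx.
by rewrite if_same; case: ifP; rewrite ffunE ?nTS.
Qed.

Lemma hcomp_sum x : \sum_(d < (\dim {:V}).+1) hcomp d x = x.
Proof.
apply/ffunP => S; rewrite sum_ffunE.
have cS : (#|S| < (\dim {:V}).+1)%N by rewrite ltnS -[X in (_ <= X)%N]card_ord max_card.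
rewrite (bigD1 (Ordinal cS)) //= ffunE eqxx big1 ?addr0 // => d.
by rewrite -val_eqE /= ffunE eq_sym => /negPf->.
Qed.

Definition homog d x := hcomp d x = x.

Lemma homog_ebase S : homog #|S| (ebase S).
Proof. by rewrite /homog hcomp_ebase eqxx. Qed.

Lemma eq_linext_homog (W : lmodType k) (g h : {set 'I_(\dim {:V})} -> W) d x :
  homog d x -> (forall S, #|S| = d -> g S = h S) -> linext g x = linext h x.
Proof.
move=> hx gh; apply: eq_bigr => S _; case: (eqVneq #|S| d) => [/gh->//|/negPf nS].
by rewrite -hx ffunE nS !scale0r.
Qed.

Lemma homogM d e x y : homog d x -> homog e y -> homog (d + e) (x * y).
Proof.
move=> hx hy; rewrite /homog -[x * y]/(linext (fun S => linext _ _) _).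
rewrite (linear_linext (hcomp _)); apply: (eq_linext_homog hx) => S cS.
rewrite (linear_linext (hcomp _)); apply: (eq_linext_homog hy) => T cT.
rewrite /wedge_base; case: ifP => [dST|_]; last by rewrite linear0.
rewrite linearZ /= hcomp_ebase cardsU.
by move: dST; rewrite -setI_eq0 => /eqP->; rewrite cards0 subn0 cS cT eqxx.
Qed.

Lemma homog1 : homog 0 1.
Proof. by rewrite /homog [LHS]hcomp_ebase cards0 eqxx. Qed.

Lemma homog_extv v : homog 1 (extv v).
Proof.
rewrite /homog /extv linear_sum; apply: eq_bigr => i _.
by rewrite linearZ /= hcomp_ebase cards1 eqxx.
Qed.

Lemma homog_prod vs : homog (size vs) (\prod_(v <- vs) extv v).
Proof.
elim: vs => [|v vs IHvs]; first by rewrite big_nil; apply: homog1.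
by rewrite big_cons; apply: (homogM (homog_extv v) IHvs).
Qed.

(* The graded tensor product of two copies of the exterior algebra: the basis  *)
(* element (S, T) stands for ebase S (x) ebase T, and the product obeys        *)
(* (x (x) y)(z (x) w) = (-1)^(|y||z|) xz (x) yw; see gtensor_tensM.            *)
Definition gtensor :=
  {ffun {set 'I_(\dim {:V})} * {set 'I_(\dim {:V})} -> k^o}.
HB.instance Definition _ := Vector.copy gtensor
  {ffun {set 'I_(\dim {:V})} * {set 'I_(\dim {:V})} -> k^o}.
Implicit Types p q r : {set 'I_(\dim {:V})} * {set 'I_(\dim {:V})}.

Definition tens (x y : exterior) : gtensor :=
  bilext (fun S T => fdelta k (S, T)) x y.
HB.instance Definition _ x := GRing.isLinear.Build k exterior gtensor *:%R
  (tens x) (bilext_linr _ x).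

Definition gtensor_base p q : gtensor :=
  (-1) ^+ (#|p.2| * #|q.1|) *:
    tens (ebase p.1 * ebase q.1) (ebase p.2 * ebase q.2).

Definition gtensor_mul : gtensor -> gtensor -> gtensor := bilext gtensor_base.

Lemma tensl y : linear (tens^~ y).
Proof. exact: bilext_linl. Qed.

Lemma tensZl c x y : tens (c *: x) y = c *: tens x y.
Proof.
have := tensl y c x 0; rewrite !addr0 => ->.
by rewrite [tens 0 y]linear0 addr0.
Qed.

Lemma tens0l y : tens 0 y = 0.
Proof. by rewrite -(scale0r 0) tensZl scale0r. Qed.

Lemma tens_ebase S T : tens (ebase S) (ebase T) = fdelta k (S, T).
Proof. exact: bilext_delta. Qed.

Lemma linext_tens (W : lmodType k) (g : _ -> W) x y :
  linext g (tens x y) = linext (fun S => linext (fun T => g (S, T)) y) x.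
Proof.
rewrite /tens /bilext (linear_linext (linext g)); apply: eq_linext => S.
rewrite (linear_linext (linext g)); apply: eq_linext => T.
exact: linext_delta.
Qed.

Lemma tens_linext (F G : exterior -> exterior) x y : linear F -> linear G ->
  linext (fun S => linext (fun T => tens (F (ebase S)) (G (ebase T))) y) x =
  tens (F x) (G y).
Proof.
move=> lF lG; rewrite -[x in RHS](@linext_id k) -[y in RHS](@linext_id k).
rewrite [in RHS](linear_linext' lF) [in RHS](linear_linext' lG).
rewrite [RHS](linear_linext' (tensl _)); apply: eq_linext => S.
by rewrite linear_linext.
Qed.

Lemma mull_lin (a : exterior) : linear ( *%R a).
Proof. by move=> c x y; rewrite mulrDr scalerAr. Qed.

Lemma mulr_lin (a : exterior) : linear ( *%R^~ a).
Proof. by move=> c x y; rewrite mulrDl scalerAl. Qed.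

Lemma linext_gtensor_base p x y d : homog d x ->
  linext (gtensor_base p) (tens x y) =
  (-1) ^+ (#|p.2| * d) *: tens (ebase p.1 * x) (ebase p.2 * y).
Proof.
move=> hx; rewrite linext_tens -tens_linext; try exact: mull_lin.
rewrite -linextZ; apply: (eq_linext_homog hx) => S cS.
by rewrite -linextZ; apply: eq_linext => T; rewrite /gtensor_base /= cS.
Qed.

Lemma linext_gtensor_basel q x y d : homog d y ->
  linext (gtensor_base^~ q) (tens x y) =
  (-1) ^+ (d * #|q.1|) *: tens (x * ebase q.1) (y * ebase q.2).
Proof.
move=> hy; rewrite linext_tens.
rewrite -(tens_linext x y (mulr_lin _) (mulr_lin _)).
rewrite -linextZ; apply: eq_linext => S.
rewrite -linextZ; apply: (eq_linext_homog hy) => T cT.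
by rewrite /gtensor_base /= cT.
Qed.

Let linext_gtensorZ (f : _ -> gtensor) c (t : gtensor) :
  linext f (c *: t) = c *: linext f t.
Proof. exact: linext_scale. Qed.

Let gtensor_baseE p q : gtensor_base p q = (-1) ^+ (#|p.2| * #|q.1|) *:
  tens (ebase p.1 * ebase q.1) (ebase p.2 * ebase q.2).
Proof. by []. Qed.

Lemma gtensor_baseA p q r :
  linext (gtensor_base^~ r) (gtensor_base p q) =
  linext (gtensor_base p) (gtensor_base q r).
Proof.
have e1 := homogM (homog_ebase p.2) (homog_ebase q.2).
have e2 := homogM (homog_ebase q.1) (homog_ebase r.1).
rewrite [gtensor_base p q]gtensor_baseE [gtensor_base q r]gtensor_baseE.
apply: (etrans (linext_gtensorZ _ _ _)); apply/esym.
apply: (etrans (linext_gtensorZ _ _ _)); apply/esym.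
apply: (etrans (congr1 ( *:%R _) (linext_gtensor_basel r _ e1))); apply/esym.
apply: (etrans (congr1 ( *:%R _) (linext_gtensor_base p _ e2))); apply/esym.
rewrite !scalerA -!exprD !mulrA; congr (_ ^+ _ *: _).
by rewrite mulnDl mulnDr addnA [RHS]addnC.
Qed.

Lemma gtensor_mulA : associative gtensor_mul.
Proof. exact/bilext_assoc/gtensor_baseA. Qed.

Lemma tensM d e x y z w : homog d y -> homog e z ->
  gtensor_mul (tens x y) (tens z w) =
  (-1) ^+ (d * e) *: tens (x * z) (y * w).
Proof.
move=> hy hz; rewrite /gtensor_mul {1}/bilext linext_tens.
rewrite -(tens_linext x y (mulr_lin z) (mulr_lin w)) -linextZ.
apply: eq_linext => S; rewrite -linextZ; apply: (eq_linext_homog hy) => T cT.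
by rewrite (linext_gtensor_base _ _ hz) /= cT.
Qed.

Lemma gtensor_expand (t : gtensor) :
  t = linext (fun p => tens (ebase p.1) (ebase p.2)) t.
Proof.
by rewrite -[LHS]linext_id; apply: eq_linext => -[S T]; rewrite tens_ebase.
Qed.

Lemma gtensor_mul1x : left_id (tens 1 1) gtensor_mul.
Proof.
move=> t; rewrite [t in LHS]gtensor_expand [RHS]gtensor_expand.
rewrite [LHS](linear_linext' (bilext_linr _ _)); apply: eq_linext => -[S T].
by rewrite [LHS](tensM _ _ homog1 (homog_ebase _)) mul0n scale1r !mul1r.
Qed.

Lemma gtensor_mulx1 : right_id (tens 1 1) gtensor_mul.
Proof.
move=> t; rewrite [t in LHS]gtensor_expand [RHS]gtensor_expand.
rewrite [LHS](linear_linext' (bilext_linl _ _)); apply: eq_linext => -[S T].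
by rewrite [LHS](tensM _ _ (homog_ebase _) homog1) muln0 scale1r !mulr1.
Qed.

Lemma gtensor_mulDl : left_distributive gtensor_mul +%R.
Proof.
by move=> x y z; have := bilext_linl gtensor_base z 1 x y; rewrite !scale1r.
Qed.

Lemma gtensor_mulDr : right_distributive gtensor_mul +%R.
Proof. by move=> x y z; rewrite /gtensor_mul linearD. Qed.

Lemma gtensor1_neq0 : tens 1 1 != 0.
Proof.
rewrite [tens 1 1]tens_ebase.
by apply/eqP => /ffunP/(_ (set0, set0))/eqP; rewrite !ffunE eqxx oner_eq0.
Qed.

HB.instance Definition _ := GRing.Zmodule_isNzRing.Build gtensor
  gtensor_mulA gtensor_mul1x gtensor_mulx1 gtensor_mulDl gtensor_mulDr
  gtensor1_neq0.

Lemma gtensor_mulZl c (x y : gtensor) : c *: (x * y) = (c *: x) * y.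
Proof.
have := bilext_linl gtensor_base y c x 0; rewrite !addr0 => /esym.
by rewrite [bilext _ 0 _]linear0 addr0.
Qed.
HB.instance Definition _ :=
  GRing.Lmodule_isLalgebra.Build k gtensor gtensor_mulZl.

Lemma gtensor_mulZr c (x y : gtensor) : c *: (x * y) = x * (c *: y).
Proof. by rewrite [RHS]linearZ. Qed.
HB.instance Definition _ :=
  GRing.Lalgebra_isAlgebra.Build k gtensor gtensor_mulZr.

(* The algebra morphism with v |-> v (x) 1 + 1 (x) v; see coproduct_extv and   *)
(* coproduct_is_monoid_morphism.                                               *)
Definition coproduct : exterior -> gtensor :=
  extlift (fun v => tens (extv v) 1 + tens 1 (extv v)).
HB.instance Definition _ := GRing.Linear.on coproduct.

Let coprod_lin : linear (fun v => tens (extv v) 1 + tens 1 (extv v)).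
Proof.
move=> c u v; rewrite !linearP tensl scalerDr -!addrA; congr (_ + _).
by rewrite addrCA.
Qed.

Lemma gtensor_tensM d e x y z w : homog d y -> homog e z ->
  tens x y * tens z w = (-1) ^+ (d * e) *: tens (x * z) (y * w).
Proof. exact: tensM. Qed.

Let coprod_sq v :
  (tens (extv v) 1 + tens 1 (extv v)) * (tens (extv v) 1 + tens 1 (extv v)) = 0.
Proof.
have e11 : tens (extv v) 1 * tens (extv v) 1 = 0.
  rewrite (gtensor_tensM _ _ homog1 (homog_extv v)) extv_sq.
  by rewrite tens0l scaler0.
have e12 : tens (extv v) 1 * tens 1 (extv v) = tens (extv v) (extv v).
  by rewrite (gtensor_tensM _ _ homog1 homog1) scale1r mulr1 mul1r.
have e21 : tens 1 (extv v) * tens (extv v) 1 = - tens (extv v) (extv v).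
  rewrite (gtensor_tensM _ _ (homog_extv v) (homog_extv v)).
  by rewrite scaleN1r mulr1 mul1r.
have e22 : tens 1 (extv v) * tens 1 (extv v) = 0.
  rewrite (gtensor_tensM _ _ (homog_extv v) homog1) extv_sq.
  by rewrite [tens _ 0]linear0 scaler0.
by rewrite mulrDl !mulrDr e11 e12 e21 e22 add0r addr0 subrr.
Qed.

Lemma coproduct_extv v : coproduct (extv v) = tens (extv v) 1 + tens 1 (extv v).
Proof. exact: (extlift_extv coprod_lin coprod_sq). Qed.

Lemma coproduct_is_monoid_morphism : monoid_morphism coproduct.
Proof. exact: (extlift_is_monoid_morphism coprod_lin coprod_sq). Qed.
HB.instance Definition _ := GRing.isMonoidMorphism.Build exterior gtensor
  coproduct coproduct_is_monoid_morphism.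

(* F w_(1) w_(2) for t = w_(1) (x) w_(2), sum understood, F bilinear; see      *)
(* sweedler_tens.                                                              *)
Definition sweedler (W : lmodType k) (F : exterior -> exterior -> W)
  (t : gtensor) : W := linext (fun p => F (ebase p.1) (ebase p.2)) t.

Lemma sweedler_tens (W : lmodType k) (F : exterior -> exterior -> W) x y :
    (forall y, linear (F^~ y)) -> (forall x, linear (F x)) ->
  sweedler F (tens x y) = F x y.
Proof.
move=> Fl Fr; rewrite /sweedler linext_tens.
rewrite -[x in RHS](@linext_id k) (linear_linext' (Fl y)); apply: eq_linext => S.
by rewrite -[y in RHS](@linext_id k) (linear_linext' (Fr _)).
Qed.

Section Form.
Implicit Type B : V -> V -> k.

Definition gram B (xs ys : seq V) : k :=
  if size xs == size ys then
    (-1) ^+ (size ys * (size ys).-1)./2 *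
      \det (\matrix_(i < size ys, j < size ys) B xs`_i ys`_j)
  else 0.

(* The extension of a bilinear B to the exterior algebra, given on basis       *)
(* elements by the Gram determinant formula; Bext_prod extends the formula to  *)
(* products of arbitrary vectors.                                              *)
Definition Bext B (u w : exterior) : k :=
  bilext (fun S T => gram B (bvecs S) (bvecs T) : k^o) u w.

Definition lcontr B (u w : exterior) : exterior :=
  sweedler (fun w1 w2 => Bext B u w1 *: w2) (coproduct w).

Lemma gramC B xs ys : gram B xs ys = gram (fun u v => B v u) ys xs.
Proof.
rewrite /gram eq_sym; case: eqP => // ->; congr (_ * _).
by rewrite -det_tr; congr (\det _); apply/matrixP => i j; rewrite !mxE.
Qed.

Lemma gram_linear B (ys p s : seq V) : (forall v, linear (B^~ v : V -> k^o)) ->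
  linear (fun v => gram B (p ++ v :: s) ys : k^o).
Proof.
move=> Bl c u v; rewrite /gram !size_cat /=; case: eqP => [e|_]; last first.
  by rewrite scaler0 addr0.
have lt_p : (size p < size ys)%N by rewrite -e addnS ltnS leq_addr.
have nE0 w : (p ++ w :: s)`_(size p) = w by rewrite nth_cat ltnn subnn.
have nE w w' i : i != size p -> (p ++ w :: s)`_i = (p ++ w' :: s)`_i.
  rewrite !nth_cat; case: ltngtP => // lti _.
  by rewrite -subn_gt0 in lti; case: (i - size p)%N lti.
rewrite (determinant_multilinear (i0 := Ordinal lt_p) (b := c) (c := 1)
   (B := \matrix_(i, j) B (p ++ u :: s)`_i ys`_j)
   (C := \matrix_(i, j) B (p ++ v :: s)`_i ys`_j)).
- by rewrite mul1r mulrDr mulrCA.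
- by apply/rowP => j; rewrite !mxE /= !nE0 Bl mul1r.
- apply/matrixP => i j; rewrite !mxE; congr (B _ _); apply: nE.
  by rewrite eq_sym; apply: neq_bump.
- apply/matrixP => i j; rewrite !mxE; congr (B _ _); apply: nE.
  by rewrite eq_sym; apply: neq_bump.
Qed.

Lemma gram_alt B (ys p : seq V) v s : gram B (p ++ v :: v :: s) ys = 0.
Proof.
rewrite /gram size_cat /=; case: eqP => // e.
have lt1 : (size p < size ys)%N by rewrite -e addnS ltnS leq_addr.
have lt2 : ((size p).+1 < size ys)%N by rewrite -e !addnS !ltnS leq_addr.
rewrite (determinant_alternate (i1 := Ordinal lt1) (i2 := Ordinal lt2)) ?mulr0 //.
  by rewrite -val_eqE /= -[X in X != _]addn0 -addn1 eqn_add2l.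
by move=> j; rewrite !mxE /= !nth_cat ltnn subnn ltnNge leqnSn /= subSnn.
Qed.

Let Bext_l B (ys : seq V) xs : (forall v, linear (B^~ v : V -> k^o)) ->
  linext (fun S => gram B (bvecs S) ys : k^o) (\prod_(v <- xs) extv v) =
  gram B xs ys.
Proof.
move=> Bl; pose D xs : k^o := gram B xs ys.
have Dl (p s : seq V) : linear (fun v => D (p ++ v :: s)) by apply: gram_linear.
have Da (p : seq V) v s : D (p ++ v :: v :: s) = 0 by apply: gram_alt.
rewrite -[LHS]/(altext D [::] _) -[X in altext _ _ X]mulr1.
by rewrite (altext_prod Dl Da) altext1.
Qed.

Lemma Bext_prod B xs ys : (forall v, linear (B^~ v : V -> k^o)) ->
    (forall u, linear (B u : V -> k^o)) ->
  Bext B (\prod_(x <- xs) extv x) (\prod_(y <- ys) extv y) = gram B xs ys.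
Proof.
move=> Bl Br; rewrite gramC /Bext bilextC.
apply: etrans (Bext_l xs ys (B := fun u v => B v u) Br).
rewrite {1}/bilext; apply: eq_linext => T; rewrite -gramC.
exact: (Bext_l (bvecs T) xs Bl).
Qed.
End Form.
End ExteriorAlgebra.

(* Main.v *)
From HB Require Import structures.
Require Import Defs.
From mathcomp Require Import all_boot all_order all_algebra ring.
Import GRing.Theory.
Local Open Scope ring_scope.

Set Implicit Arguments.
Unset Strict Implicit.
Unset Printing Implicit Defensive.

(** Contraction by a single vector, [d_x := lcontr B (extv x)], is an odd
derivation of the exterior algebra: it satisfies
[d_x (y z) = B x y *: z - y d_x z] for a vector [y] ([lcontr_extvM]), hence the
graded Leibniz rule ([lcontr_extv_derivation]).  The contraction turns the
exterior algebra into a left module over itself: contracting by [x a] is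
contracting by [a], then by [x] ([lcontr_extvMl]).  Given these two facts the
formula follows by induction on [w]: it is trivial for [w = 1], and if it holds
for [w], applying [d_x] to each term of the sum produces two terms by the
Leibniz rule, which are exactly the two terms that the factor
[x (x) 1 + 1 (x) x] of the coproduct of [x w] produces from it
([sweedler_coproductM]); the sign [(-1)^|w1|] needed to move [x] past [w1] is
the one produced by commuting [d_x] with the [|w1|]-th power of the grade
involution ([lcontr_extv_gradeinv]).

The module law is where the determinants enter.  Let [D] be an iterated
contraction [d_x1 ... d_xr].  Each [d_x] acts on the left leg of the coproduct
only ([sweedler_coproduct_lcontr]), so the same holds for [D], and by the
counit law ([lcontr1l]) [D w] is the sum of [eps (D w1) *: w2], where
[eps = Bext B 1] is the counit.  On a product of vectors, [eps] of the
iterated contraction expands in the same way as the Gram determinant does along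
its last row ([Bext1_iter_lcontr]); hence [eps (D w1) = Bext B (x1 ... xr) w1],
and [D] is the contraction by [x1 ... xr] ([lcontr_prod]). *)

(** * Induction principles and the grade involution *)

Section Exterior.
Variables (k : fieldType) (V : vectType k).
Local Notation E := (exterior V).
Implicit Types (x y : V) (a b w z : E).

Let prod_nil : \prod_(v <- [::]) extv v = 1 :> E.
Proof. exact: big_nil. Qed.

Let prod_seq1 x : \prod_(v <- [:: x]) extv v = extv x :> E.
Proof. exact: big_seq1. Qed.

Let prod_cons x xs :
  \prod_(v <- x :: xs) extv v = extv x * \prod_(v <- xs) extv v :> E.
Proof. exact: big_cons. Qed.

Let linear_scale (U W : lmodType k) (f : U -> W) :
  linear f -> forall c u, f (c *: u) = c *: f u.
Proof. exact: GRing.scalable_linear. Qed.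

Lemma exterior_ind (P : E -> Prop) :
  P 1 -> (forall y z, P z -> P (extv y * z)) ->
  (forall c a b, P a -> P b -> P (c *: a + b)) -> forall w, P w.
Proof.
move=> P1 PM PL.
have P0 : P 0 by rewrite -(addNr 1) -scaleN1r; apply: PL.
have Pprod vs : P (\prod_(v <- vs) extv v).
  by elim: vs => [|v vs IH]; rewrite ?big_nil ?big_cons //; apply: PM.
move=> w; rewrite -[w](@linext_id k) /linext.
apply: big_ind => // [a b Pa Pb|S _]; first by rewrite -[a]scale1r; apply: PL.
by rewrite -[_ *: _]addr0; apply: PL => //; rewrite -/(ebase S) -prod_bvecs.
Qed.

Lemma eq_linear_ebase (W : lmodType k) (f g : E -> W) : linear f -> linear g ->
  (forall S, f (ebase S) = g (ebase S)) -> f =1 g.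
Proof.
move=> lf lg fg w; rewrite -[w](@linext_id k).
rewrite (linear_linext' lf) (linear_linext' lg).
exact: eq_linext.
Qed.

(** The [p]-th power of the grade involution, the algebra automorphism that is
[-1] on vectors.  Keeping the exponent turns the double sum over grades of the
theorem into products with [gradeinv p]; see [leibniz_term_homog]. *)
Definition gradeinv (p : nat) a : E :=
  \sum_(q < (\dim {:V}).+1) (-1) ^+ (p * q) *: hcomp q a.

Lemma gradeinv_linear p : linear (gradeinv p).
Proof.
move=> c a b; rewrite /gradeinv scaler_sumr -big_split.
apply: eq_bigr => q _ /=; rewrite linearP scalerDr !scalerA.
by congr (_ *: _ + _); rewrite mulrC.
Qed.
HB.instance Definition _ p :=
  GRing.isLinear.Build k E E *:%R (gradeinv p) (gradeinv_linear p).

Lemma gradeinv_ebase p S :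
  gradeinv p (ebase S) = (-1) ^+ (p * #|S|) *: ebase S :> E.
Proof.
rewrite -[in RHS](hcomp_sum (ebase S)) scaler_sumr; apply: eq_bigr => q _.
by rewrite hcomp_ebase; case: eqP => [->//|_]; rewrite !scaler0.
Qed.

Lemma gradeinv_homog p d a : homog d a -> gradeinv p a = (-1) ^+ (p * d) *: a.
Proof.
move=> ha; rewrite -[a in LHS](@linext_id k) -[a in RHS](@linext_id k).
rewrite (linear_linext (gradeinv p)) -linextZ; apply: (eq_linext_homog ha).
by move=> S <-; apply: gradeinv_ebase.
Qed.

Lemma gradeinv0 a : gradeinv 0 a = a.
Proof.
by rewrite -[RHS]hcomp_sum; apply: eq_bigr => q _; rewrite scale1r.
Qed.

Lemma gradeinv1 p : gradeinv p 1 = 1 :> E.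
Proof. by rewrite (gradeinv_homog _ (homog1 V)) muln0 scale1r. Qed.

Lemma gradeinvMl p y a :
  gradeinv p (extv y * a) = (-1) ^+ p *: (extv y * gradeinv p a).
Proof.
move: a; apply: eq_linear_ebase => [c a b|c a b|S].
- by rewrite mulrDr -scalerAr linearP.
- by rewrite linearP mulrDr -scalerAr scalerDr !scalerA mulrC.
rewrite (gradeinv_homog _ (homogM (homog_extv y) (homog_ebase S))).
by rewrite gradeinv_ebase -scalerAr scalerA -exprD mulnDr muln1.
Qed.

Lemma gradeinvD p q a : gradeinv p (gradeinv q a) = gradeinv (p + q) a.
Proof.
move: a; apply: eq_linear_ebase => [c a b|c a b|S]; rewrite ?linearP //.
by rewrite !gradeinv_ebase linearZ /= gradeinv_ebase scalerA -exprD mulnDl addnC.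
Qed.

(** * Sums over the coproduct *)

Section Sweedler.
Variables (W : lmodType k).
Implicit Types (F G : E -> E -> W) (t : gtensor V).

Lemma eq_sweedler F G t :
  (forall S T, F (ebase S) (ebase T) = G (ebase S) (ebase T)) ->
  sweedler F t = sweedler G t.
Proof. by move=> FG; apply: eq_linext => -[S T]; apply: FG. Qed.

Lemma sweedler_linear F : linear (sweedler F).
Proof. exact: linext_is_linear. Qed.

Lemma linear_sweedler (W' : lmodType k) (g : W -> W') F t : linear g ->
  g (sweedler F t) = sweedler (fun a b => g (F a b)) t.
Proof. by move=> lg; apply: linear_linext'. Qed.

(** Multiplying by [y] on the second leg costs the sign of moving [y] past the
first leg, which the grade involution applied to that leg records on all
grades at once. *)
Lemma sweedlerM F y t : (forall b, linear (F^~ b)) -> (forall a, linear (F a)) ->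
  sweedler F ((tens (extv y) 1 + tens 1 (extv y)) * t) =
  sweedler (fun a b => F (extv y * a) b + F (gradeinv 1 a) (extv y * b)) t.
Proof.
move=> Fl Fr; have lF := sweedler_linear F.
pose gm t' := sweedler F ((tens (extv y) 1 + tens 1 (extv y)) * t').
have lgm : linear gm by move=> c t1 t2; rewrite /gm mulrDr -scalerAr lF.
rewrite -/(gm t) [t in LHS]gtensor_expand (linear_linext' lgm).
apply: eq_linext => -[S T] /=; rewrite /gm mulrDl.
rewrite (gtensor_tensM _ _ (homog1 V) (homog_ebase S)) mul0n expr0 mul1r.
rewrite (gtensor_tensM _ _ (homog_extv y) (homog_ebase S)) mul1n mul1r.
rewrite scale1r addrC lF !sweedler_tens // addrC; congr (_ + _).
by rewrite gradeinv_ebase mul1n (linear_scale (Fl _)).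
Qed.

Lemma sweedler_coproductM F y z :
    (forall b, linear (F^~ b)) -> (forall a, linear (F a)) ->
  sweedler F (coproduct (extv y * z)) =
  sweedler (fun a b => F (extv y * a) b + F (gradeinv 1 a) (extv y * b))
    (coproduct z).
Proof. by move=> Fl Fr; rewrite rmorphM /= coproduct_extv sweedlerM. Qed.
End Sweedler.

(** * Contraction by a vector *)

Section Contraction.
Variable B : {biscalar V}.

Let B_linl v : linear (B^~ v : V -> k^o).
Proof. by move=> c x y; rewrite linearPl. Qed.

Let B_linr u : linear (B u : V -> k^o).
Proof. by move=> c x y; rewrite linearPr. Qed.

Lemma Bext_linl w : linear ((Bext B)^~ w : E -> k^o).
Proof. exact: bilext_linl. Qed.

Lemma Bext_linr a : linear (Bext B a : E -> k^o).
Proof. exact: bilext_linr. Qed.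

Lemma lcontr_linr a : linear (lcontr B a).
Proof. by move=> c w z; rewrite /lcontr linearP sweedler_linear. Qed.
HB.instance Definition _ a :=
  GRing.isLinear.Build k E E *:%R (lcontr B a) (lcontr_linr a).

Lemma lcontr_linl w : linear ((lcontr B)^~ w).
Proof.
move=> c a b; rewrite /lcontr /sweedler -linextZ -linextD.
apply: eq_linext => p; rewrite scalerA -scalerDl.
congr (_ *: _); exact: Bext_linl.
Qed.

Lemma size_bvecs (S : {set 'I_(\dim {:V})}) : size (bvecs S) = #|S|.
Proof. by rewrite /bvecs size_map -cardE. Qed.

(** [Bext B 1] does not depend on [B]: it is the counit of the exterior algebra,
the projection onto grade 0. *)
Lemma Bext1_prod ys :
  Bext B 1 (\prod_(y <- ys) extv y) = (size ys == 0)%N%:R.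
Proof.
rewrite -{1}prod_nil Bext_prod // /gram /=.
by case: ys => //=; rewrite det_mx00 expr0 mulr1.
Qed.

Lemma Bext1_ebase S : Bext B 1 (ebase S) = (#|S| == 0)%N%:R.
Proof. by rewrite -prod_bvecs Bext1_prod size_bvecs. Qed.

Lemma Bext_extv_prod x ys : Bext B (extv x) (\prod_(y <- ys) extv y) =
  if size ys == 1%N then B x ys`_0 else 0.
Proof.
rewrite -prod_seq1 Bext_prod // /gram /= eq_sym.
by case: ys => [|y []] //=; rewrite det_mx11 mxE expr0 mul1r.
Qed.

Lemma BextZr a c w : Bext B a (c *: w) = c * Bext B a w.
Proof. exact: (linear_scale (Bext_linr a)). Qed.

Lemma Bext1_extvM y S : Bext B 1 (extv y * ebase S) = 0.
Proof. by rewrite -prod_bvecs -prod_cons Bext1_prod. Qed.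

Lemma Bext_extvM x y S :
  Bext B (extv x) (extv y * ebase S) = B x y * Bext B 1 (ebase S).
Proof.
rewrite Bext1_ebase -prod_bvecs -prod_cons Bext_extv_prod /= eqSS size_bvecs.
by case: eqP; rewrite ?mulr1 ?mulr0.
Qed.

Lemma Bext1_gradeinv S : Bext B 1 (gradeinv 1 (ebase S)) = Bext B 1 (ebase S).
Proof.
rewrite gradeinv_ebase mul1n BextZr Bext1_ebase.
by case: eqP => [->|_]; rewrite ?mulr0 ?mulr1.
Qed.

Lemma Bext_extv_gradeinv x S :
  Bext B (extv x) (gradeinv 1 (ebase S)) = - Bext B (extv x) (ebase S).
Proof.
rewrite gradeinv_ebase mul1n BextZr -prod_bvecs Bext_extv_prod size_bvecs.
by case: eqP => [->|_]; rewrite ?mulr0 ?oppr0 ?mulN1r.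
Qed.

Let contr_term a w1 w2 : E := Bext B a w1 *: w2.

Let contr_term_linl a b : linear ((contr_term a)^~ b).
Proof. by move=> c u v; rewrite /contr_term Bext_linr scalerDl scalerA. Qed.

Let contr_term_linr a u : linear (contr_term a u).
Proof. by move=> c w z; rewrite /contr_term scalerDr !scalerA mulrC. Qed.

Let lcontrM a y z : lcontr B a (extv y * z) =
  sweedler (fun w1 w2 => Bext B a (extv y * w1) *: w2 +
    Bext B a (gradeinv 1 w1) *: (extv y * w2)) (coproduct z).
Proof.
exact: (sweedler_coproductM _ _ (contr_term_linl a) (contr_term_linr a)).
Qed.

Let coproduct1 : coproduct 1 = tens 1 1 :> gtensor V.
Proof. exact: rmorph1. Qed.

Lemma lcontr1 a : lcontr B a 1 = Bext B a 1 *: 1.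
Proof.
rewrite /lcontr coproduct1.
exact: (sweedler_tens (F := contr_term a) _ _ (contr_term_linl a) (contr_term_linr a)).
Qed.

(** The counit law of the coproduct. *)
Lemma lcontr1l z : lcontr B 1 z = z.
Proof.
move: z; apply: exterior_ind => [|y z IH|c a b IHa IHb].
- by rewrite lcontr1 -[X in Bext B _ X]prod_nil Bext1_prod scale1r.
- rewrite lcontrM -[in RHS]IH (linear_sweedler _ _ (mull_lin _)).
  apply: eq_sweedler => S T.
  by rewrite Bext1_extvM Bext1_gradeinv scale0r add0r -scalerAr.
- by rewrite lcontr_linr IHa IHb.
Qed.

Lemma lcontr_extv1 x : lcontr B (extv x) 1 = 0.
Proof.
by rewrite lcontr1 -[X in Bext B _ X]prod_nil Bext_extv_prod scale0r.
Qed.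

(** In the coproduct of [y z], pairing the left leg with [x] only sees its part
of grade 1.  This is [y w1] when [w1] is a scalar, and the counit law then
gives [B x y *: z]; or [w1] has itself grade 1, and [y] has moved past it to
the right leg with a sign [-1]. *)
Lemma lcontr_extvM x y z : lcontr B (extv x) (extv y * z) =
  B x y *: z - extv y * lcontr B (extv x) z.
Proof.
rewrite lcontrM -[z in _ *: z]lcontr1l /lcontr.
rewrite (linear_sweedler _ _ (mull_lin _)).
rewrite /sweedler -linextZ -scaleN1r -linextZ -linextD.
apply: eq_linext => -[S T] /=; rewrite Bext_extvM Bext_extv_gradeinv scalerA.
by rewrite scaleN1r scaleNr -scalerAr.
Qed.

(** Contraction by a vector lowers the grade by one. *)
Lemma lcontr_extv_gradeinv p x a :
  lcontr B (extv x) (gradeinv p a) =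
  (-1) ^+ p *: gradeinv p (lcontr B (extv x) a).
Proof.
move: a; apply: exterior_ind => [|y z IH|c a b IHa IHb].
- by rewrite gradeinv1 lcontr_extv1 linear0 scaler0.
- rewrite gradeinvMl linearZ /= !lcontr_extvM IH.
  rewrite [gradeinv p (_ - _)]linearB linearZ /= gradeinvMl !scalerBr.
  by rewrite -!scalerAr !scalerA.
- by rewrite !linearP /= IHa IHb !scalerA mulrC.
Qed.

Lemma lcontr_extv_derivation x a b : lcontr B (extv x) (a * b) =
  lcontr B (extv x) a * b + gradeinv 1 a * lcontr B (extv x) b.
Proof.
move: a; apply: exterior_ind => [|y z IH|c a a' IHa IHa'].
- by rewrite gradeinv1 lcontr_extv1 !mul1r mul0r add0r.
- rewrite -mulrA !lcontr_extvM IH gradeinvMl scaleN1r mulNr mulrBl mulrDr opprD.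
  by rewrite !mulrA addrA -scalerAl.
- rewrite mulrDl -scalerAl !linearP /= IHa IHa' !mulrDl scalerDr -!scalerAl.
  exact: addrACA.
Qed.

(** * The module law *)

Let sweedler_coproduct_linear (W : lmodType k) (F : E -> E -> W) :
  linear (fun w => sweedler F (coproduct w)).
Proof. by move=> c a b; rewrite linearP sweedler_linear. Qed.

(** Contraction by [x] commutes with the coaction [w |-> w1 (x) w2] when it acts
on the left leg.  The statement quantifies over all bilinear [F] because the
induction on [w] replaces [F] by the form [Fy] that absorbs a factor [y] of the
coproduct. *)
Lemma sweedler_coproduct_lcontr (W : lmodType k) (F : E -> E -> W) x w :
    (forall b, linear (F^~ b)) -> (forall a, linear (F a)) ->
  sweedler F (coproduct (lcontr B (extv x) w)) =
  sweedler (fun a b => F (lcontr B (extv x) a) b) (coproduct w).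
Proof.
move: w F; apply: (@exterior_ind (fun w => forall F, _))
  => [|y z IH|c a b IHa IHb] F Fl Fr.
- rewrite lcontr_extv1 coproduct1.
  rewrite (@sweedler_tens _ _ _ (fun a b => F (lcontr B (extv x) a) b)) //.
    rewrite lcontr_extv1 -(scale0r (0 : E)) (linear_scale (Fl _)).
    by rewrite (linear_scale (sweedler_coproduct_linear F)) !scale0r.
  by move=> b c a1 a2; rewrite linearP Fl.
- pose Fy a b := F (extv y * a) b + F (gradeinv 1 a) (extv y * b).
  have Fyl b : linear (Fy^~ b).
    move=> c a1 a2; rewrite /Fy mulrDr -scalerAr linearP /= !Fl.
    by rewrite scalerDr addrACA.
  have Fyr a : linear (Fy a).
    move=> c b1 b2; rewrite /Fy mulrDr -scalerAr !Fr.
    by rewrite scalerDr addrACA.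
  rewrite lcontr_extvM -scaleN1r addrC (sweedler_coproduct_linear F).
  rewrite [sweedler F (coproduct (extv y * _))]sweedler_coproductM // -/Fy.
  rewrite -[sweedler _ _ in X in _ *: X]/(sweedler Fy _) IH //.
  rewrite (sweedler_coproductM (F := fun a b => F (lcontr B (extv x) a) b)) //;
    last by move=> b c a1 a2; rewrite linearP Fl.
  rewrite (linear_scale (sweedler_coproduct_linear F)).
  rewrite /sweedler -!linextZ -linextD; apply: eq_linext => -[S T] /=.
  rewrite lcontr_extvM [_ - _]addrC -scaleN1r Fl lcontr_extv_gradeinv expr1.
  rewrite /Fy !(linear_scale (Fl _)) scalerDr -!addrA; congr (_ + _).
  exact: addrC.
- rewrite linearP; apply: etrans (sweedler_coproduct_linear F _ _ _) _.
  apply/esym; apply: etrans (sweedler_coproduct_linear _ _ _ _) _.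
  by congr (_ *: _ + _); apply/esym; [apply: IHa | apply: IHb].
Qed.

Lemma lcontr_extv_prod x ys : lcontr B (extv x) (\prod_(y <- ys) extv y) =
  \sum_(j < size ys) ((-1) ^+ j * B x ys`_j) *:
    \prod_(y <- take j ys ++ drop j.+1 ys) extv y.
Proof.
elim: ys => [|y ys IH]; first by rewrite prod_nil lcontr_extv1 big_ord0.
rewrite prod_cons lcontr_extvM IH big_ord_recl /= drop0 expr0 mul1r.
congr (_ + _); rewrite mulr_sumr -sumrN; apply: eq_bigr => j _.
by rewrite prod_cons exprS mulN1r mulNr scaleNr -scalerAr.
Qed.

Lemma gramE n (xs ys : seq V) : size xs = n -> size ys = n ->
  gram B xs ys = (-1) ^+ 'C(n, 2) * \det (\matrix_(i < n, j < n) B xs`_i ys`_j).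
Proof. by move=> sx sy; rewrite -sy in sx *; rewrite /gram sx eqxx bin2. Qed.

(** Laplace expansion along the last row.  The cofactor of column [j] carries the
sign [(-1)^(n + j)], and [(-1)^n] is also the quotient of the sign conventions
[(-1)^'C(n.+1, 2)] and [(-1)^'C(n, 2)] of the two Gram determinants: only
[(-1)^j] remains, as in [lcontr_extv_prod]. *)
Lemma gram_rcons xs x ys : gram B (rcons xs x) ys =
  \sum_(j < size ys) ((-1) ^+ j * B x ys`_j) *
    gram B xs (take j ys ++ drop j.+1 ys).
Proof.
have szD (j : 'I_(size ys)) : size (take j ys ++ drop j.+1 ys) = (size ys).-1.
  rewrite size_cat size_drop size_take ltn_ord.
  by case: (size ys) j => [[]|n j] //=; rewrite subSS subnKC // -ltnS.
have [sz|nsz] := eqVneq (size ys) (size xs).+1; last first.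
  rewrite /gram size_rcons eq_sym (negPf nsz) big1 // => j _.
  rewrite szD; case: eqP => [e|]; last by rewrite mulr0.
  by case/eqP: nsz; rewrite e prednK // (leq_ltn_trans _ (ltn_ord j)).
set n := size xs in sz.
rewrite (@gramE n.+1) ?size_rcons // (expand_det_row _ ord_max) mulr_sumr.
move: szD; rewrite sz => szD.
apply: eq_bigr => j _; rewrite (@gramE n) ?szD // mxE /= nth_rcons ltnn eqxx.
rewrite /cofactor binS bin1 !exprD /=.
have -> : row' ord_max (col' j
    (\matrix_(i < n.+1, i' < n.+1) B (rcons xs x)`_i ys`_i'))
    = \matrix_(i, i') B xs`_i (take j ys ++ drop j.+1 ys)`_i'.
  apply/matrixP => i i'; rewrite !mxE /=; congr (B _ _).
    have -> : bump n i = i by rewrite /bump leqNgt ltn_ord.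
    by rewrite nth_rcons ltn_ord.
  rewrite nth_cat size_take sz ltn_ord /bump ltnNge.
  case: (leqP j i') => [le|lt] /=; last by rewrite nth_take.
  by rewrite nth_drop add1n addSn subnKC.
set s := (-1) ^+ _; set t := (-1) ^+ n; set c := (-1) ^+ _; set d := \det _.
have tt : t * t = 1 by rewrite -expr2 sqrr_sign.
by transitivity (t * t * (c * B x ys`_j * (s * d))); [ring | rewrite tt mul1r].
Qed.

Let iter_lcontr (xs : seq V) w := foldr (fun x => lcontr B (extv x)) w xs.

Let iter_lcontr_linear xs : linear (iter_lcontr xs).
Proof.
elim: xs => //= x xs IH c a b.
by rewrite [LHS](congr1 (lcontr B _) (IH _ _ _)) linearP.
Qed.

(** Both sides satisfy the same recursion on the last vector of [xs], given by
[lcontr_extv_prod] and [gram_rcons]. *)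
Lemma Bext1_iter_lcontr xs ys :
  Bext B 1 (iter_lcontr xs (\prod_(y <- ys) extv y)) = gram B xs ys.
Proof.
elim/last_ind: xs ys => [|xs x IH] ys.
  rewrite Bext1_prod /gram /= eq_sym.
  by case: ys => //=; rewrite det_mx00 expr0 mulr1.
rewrite /iter_lcontr foldr_rcons -/(iter_lcontr _ _) lcontr_extv_prod gram_rcons.
pose f w : k^o := Bext B 1 (iter_lcontr xs w).
have lf : linear f by move=> c a b; rewrite /f iter_lcontr_linear Bext_linr.
pose F := GRing.isLinear.Build k E k^o *:%R f lf.
pose f' : {linear E -> k^o} := HB.pack f F.
rewrite -[LHS]/(f' _) linear_sum; apply: eq_bigr => j _.
by rewrite linearZ /= /f IH.
Qed.

(** The iterated contraction acts on the left leg of the coproduct, so it is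
determined by its composite with the counit. *)
Lemma lcontr_prod xs w :
  lcontr B (\prod_(x <- xs) extv x) w = iter_lcontr xs w.
Proof.
suff H F : (forall b, linear (F^~ b)) -> (forall a, linear (F a)) ->
    sweedler F (coproduct (iter_lcontr xs w)) =
    sweedler (fun a b => F (iter_lcontr xs a) b) (coproduct w) :> E.
  rewrite -[RHS]lcontr1l [RHS](H (contr_term 1)) //.
  apply: eq_sweedler => S T; rewrite /contr_term; congr (_ *: _).
  by rewrite -prod_bvecs Bext1_iter_lcontr Bext_prod.
elim: xs F => //= x xs IH F Fl Fr.
rewrite (sweedler_coproduct_lcontr x _ Fl Fr).
pose G a b := F (lcontr B (extv x) a) b.
have Gl b : linear (G^~ b) by move=> c a1 a2; rewrite /G linearP Fl.
have Gr a : linear (G a) by apply: Fr.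
exact: (IH G Gl Gr).
Qed.

Lemma lcontr_extvMl x a w :
  lcontr B (extv x * a) w = lcontr B (extv x) (lcontr B a w).
Proof.
move: a; apply: eq_linear_ebase => [c a b|c a b|S].
- by rewrite mulrDr -scalerAr lcontr_linl.
- by rewrite lcontr_linl linearP.
by rewrite -prod_bvecs -prod_cons !lcontr_prod.
Qed.

(** * The Leibniz rule for arbitrary multivectors *)

Let leibniz_term u v w1 w2 : E :=
  \sum_(p < (\dim {:V}).+1) \sum_(q < (\dim {:V}).+1)
    (-1) ^+ (p * q) *:
      (hcomp q (lcontr B w2 u) * lcontr B (hcomp p w1) v).

Let leibniz_term_linr u v w1 : linear (leibniz_term u v w1).
Proof.
move=> c a b; rewrite /leibniz_term scaler_sumr -big_split; apply: eq_bigr => p _ /=.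
rewrite scaler_sumr -big_split; apply: eq_bigr => q _ /=.
rewrite lcontr_linl linearP mulrDl scalerDr -scalerAl !scalerA.
by rewrite [_ * c]mulrC.
Qed.

Let leibniz_term_linl u v w2 : linear ((leibniz_term u v)^~ w2).
Proof.
move=> c a b; rewrite /leibniz_term scaler_sumr -big_split; apply: eq_bigr => p _ /=.
rewrite scaler_sumr -big_split; apply: eq_bigr => q _ /=.
by rewrite linearP lcontr_linl mulrDr scalerDr -scalerAr !scalerA [_ * c]mulrC.
Qed.

(** On a homogeneous [w1] of grade [d], only the summands [p = d] survive, and
the sum over [q] is the [d]-th power of the grade involution. *)
Let leibniz_term_homog d u v w1 w2 : homog d w1 ->
  leibniz_term u v w1 w2 = gradeinv d (lcontr B w2 u) * lcontr B w1 v.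
Proof.
move=> hd; pose g a := gradeinv d (lcontr B w2 u) * lcontr B a v.
have lg : linear g.
  by move=> c a b; rewrite /g lcontr_linl mulrDr -scalerAr.
rewrite -/(g w1) -[w1](@linext_id k) (linear_linext' lg).
rewrite (linear_linext' (leibniz_term_linl u v w2)); apply: (eq_linext_homog hd) => S cS.
have cSd : (#|S| < (\dim {:V}).+1)%N.
  by rewrite ltnS -[X in (_ <= X)%N]card_ord max_card.
rewrite -/(ebase S) /g /leibniz_term (bigD1 (Ordinal cSd)) //=.
rewrite [X in _ + X]big1 ?addr0; last first.
  move=> p; rewrite -val_eqE /= eq_sym => /negPf np; apply: big1 => q _.
  rewrite hcomp_ebase np /=.
  rewrite -[X in _ * lcontr _ X _](scale0r (0 : E)).
  rewrite (linear_scale (lcontr_linl v)).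
  by rewrite scale0r mulr0 scaler0.
rewrite hcomp_ebase eqxx /gradeinv mulr_suml -cS.
by apply: eq_bigr => q _; rewrite scalerAl.
Qed.

Lemma lcontr_leibniz u v w :
  lcontr B w (u * v) = sweedler (leibniz_term u v) (coproduct w).
Proof.
move: w; apply: exterior_ind => [|x z IH|c a b IHa IHb].
- rewrite coproduct1 (sweedler_tens _ _ (leibniz_term_linl u v) (leibniz_term_linr u v)).
  by rewrite (leibniz_term_homog _ _ _ (homog1 V)) !lcontr1l gradeinv0.
- rewrite lcontr_extvMl IH (linear_sweedler _ _ (lcontr_linr _)).
  rewrite (sweedler_coproductM _ _ (leibniz_term_linl u v) (leibniz_term_linr u v)).
  (* The summand with [x] on the left leg matches the Leibniz term in which
     [x] contracts [v], the one with [x] on the right leg the term in which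
     it contracts [u]. *)
  apply: eq_sweedler => S T; rewrite gradeinv_ebase mul1n.
  rewrite (leibniz_term_homog _ _ _ (homogM (homog_extv x) (homog_ebase S))).
  rewrite (leibniz_term_homog _ _ _ (homog_ebase S)) lcontr_extv_derivation.
  rewrite gradeinvD lcontr_extv_gradeinv -!lcontr_extvMl addrC; congr (_ + _).
  rewrite (linear_scale (leibniz_term_linl _ _ _)).
  by rewrite (leibniz_term_homog _ _ _ (homog_ebase S)) -scalerAl.
- by rewrite lcontr_linl IHa IHb sweedler_coproduct_linear.
Qed.
End Contraction.
End Exterior.

Theorem mainTheorem8 (k : fieldType) (V : vectType k) (B : {biscalar V})
    (u v w : exterior V) :
  lcontr B w (u * v) =
  sweedler (fun w1 w2 : exterior V =>
      \sum_(p < (\dim {:V}).+1) \sum_(q < (\dim {:V}).+1)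
        (-1) ^+ (p * q) *:
          (hcomp q (lcontr B w2 u) * lcontr B (hcomp p w1) v))
    (coproduct w).
Proof. exact: lcontr_leibniz. Qed.
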